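(* Let $X$ and $Y$ be two arbitrary sets and $c\colon X\times Y\to[-\infty,+\infty]$ an arbitrary function. (A) Given $x_0,x_1,\tilde x\in X$ and $\bar y\in Y$ such that $c(x_0,\bar y)$, $c(x_1,\bar y)$ are finite, and given $s\in(0,1)$, the following statements are equivalent. (i) $c(\tilde x,\bar y)$ is finite and for all $y\in Y$, $c(\tilde x,\bar y)-c(\tilde x,y)\le(1-s)[c(x_0,\bar y)-c(x_0,y)]+s[c(x_1,\bar y)-c(x_1,y)]$, with undefined combinations in the right-hand side assigned the value $+\infty$. (ii) For all $\phi_0,\phi_1\in\widetilde\Phi^c$, $x_0\in\partial^c\phi_0(\bar y)$ and $x_1\in\partial^c\phi_1(\bar y)$ necessarily implies $\tilde x\in\partial^c\phi_s(\bar y)$. (iii) For all $\phi_0,\phi_1\colon Y\to[-\infty,+\infty]$, $x_0\in\partial^c\phi_0(\bar y)$ and $x_1\in\partial^c\phi_1(\bar y)$ necessarily implies $\tilde x\in\partial^c\phi_s(\bar y)$. (B) The following statements are equivalent. (iv) $(X\times Y,c)$ is an NNCC space. (v) $\widetilde\Phi^c$ is convex, in the sense that $\phi_0,\phi_1\in\widetilde\Phi^c$ implies $\phi_s\in\widetilde\Phi^c$ for every $0<s<1$. Here $\phi_s(y)=(1-s)\phi_0(y)+s\,\phi_1(y)$, with the rule $(+\infty)+(-\infty)=(-\infty)+(+\infty)=-\infty$.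
   Context: Undefined combinations are $(+\infty)+(-\infty)$, $(-\infty)+(+\infty)$, $(+\infty)-(+\infty)$, $(-\infty)-(-\infty)$; other sums follow the usual arithmetic of $[-\infty,+\infty]$. The c-transform of $\phi\colon Y\to[-\infty,+\infty]$ is $\phi^c\colon X\to[-\infty,+\infty]$, $\phi^c(x)=\inf_{y\in Y}c(x,y)-\phi(y)$, with the rule $(+\infty)-(+\infty)=(-\infty)-(-\infty)=+\infty$ inside the infimum. The c-subdifferential of $\phi$ at a point $\bar y\in Y$ where $\phi(\bar y)$ is finite is $\partial^c\phi(\bar y)=\{x\in X : c(x,\bar y)\text{ is finite and }\phi^c(x)+\phi(\bar y)=c(x,\bar y)\}$; if $\phi(\bar y)=\pm\infty$ then $\partial^c\phi(\bar y)=\emptyset$. Define $$\widetilde\Phi^c=\{\phi\colon Y\to[-\infty,+\infty] : \partial^c\phi(y)\ne\emptyset\text{ at every point }y\in Y\text{ where }\phi\text{ is finite}\}.$$ Given a path $\mathrm x\colon[0,1]\to X$ (an arbitrary function; no continuity is required) and $\bar y\in Y$, the pair $(\mathrm x,\bar y)$ is a variational c-segment on $(X\times Y,c)$ if $c(\mathrm x(s),\bar y)$ is finite for all $s\in[0,1]$ and, for all $s\in(0,1)$ and $y\in Y$, $$c(\mathrm x(s),\bar y)-c(\mathrm x(s),y)\le (1-s)[c(\mathrm x(0),\bar y)-c(\mathrm x(0),y)]+s[c(\mathrm x(1),\bar y)-c(\mathrm x(1),y)],$$ with the rule $(+\infty)+(-\infty)=(-\infty)+(+\infty)=+\infty$ in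 the right-hand side. $(X\times Y,c)$ is an NNCC space if for every $(x_0,x_1,\bar y)\in X\times X\times Y$ such that $c(x_0,\bar y)$ and $c(x_1,\bar y)$ are finite, there exists a variational c-segment $(\mathrm x,\bar y)$ with $\mathrm x(0)=x_0$, $\mathrm x(1)=x_1$. *)

(* Defs.v *)
From mathcomp Require Import all_boot all_order all_algebra.
From mathcomp Require Import all_classical all_reals ereal.

Set Implicit Arguments.
Unset Strict Implicit.
Unset Printing Implicit Defensive.

Import Order.TTheory GRing.Theory Num.Theory.

Local Open Scope classical_set_scope.
Local Open Scope ring_scope.

(* Convention on undefined sums in [\bar R]: the sum of +oo and -oo is -oo for
   the addition of scope %E and +oo for the (dual) addition of scope %dE. *)

Section NNCC.
Context {R : realType} {X Y : Type}.
Implicit Types (c : X -> Y -> \bar R) (phi : Y -> \bar R).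

(* In %dE, (+oo) - (+oo) = (-oo) - (-oo) = +oo. *)
Definition ctransform c phi (x : X) : \bar R :=
  ereal_inf [set ((c x y - phi y)%dE : \bar R) | y in [set: Y]].

(* The sum below is never undefined, since [phi ybar] is finite. *)
Definition csubdiff c phi (ybar : Y) : set X :=
  [set x | [/\ phi ybar \is a fin_num, c x ybar \is a fin_num
             & (ctransform c phi x + phi ybar)%E = c x ybar]].

Definition Phi_tilde c : set (Y -> \bar R) :=
  [set phi | forall y, phi y \is a fin_num -> csubdiff c phi y !=set0].

Definition phi_interp (s : R) (phi0 phi1 : Y -> \bar R) (y : Y) : \bar R :=
  ((1 - s)%:E * phi0 y + s%:E * phi1 y)%E.

(* Only used when [c x0 ybar], [c xs ybar] and [c x1 ybar] are finite, so that
   the only sum that can be undefined is the outer one on the right-hand side,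
   which then takes the value +oo. *)
Definition cseg_ineq c (ybar : Y) (s : R) (x0 xs x1 : X) : Prop :=
  forall y : Y,
    (c xs ybar - c xs y <=
      ((1 - s)%:E * (c x0 ybar - c x0 y)%E
       + s%:E * (c x1 ybar - c x1 y)%E)%dE)%E.

(* A path [0, 1] -> X is encoded as a function on R, of which only the values
   on [0, 1] matter. *)
Definition variational_csegment c (x : R -> X) (ybar : Y) : Prop :=
  (forall s : R, 0 <= s <= 1 -> c (x s) ybar \is a fin_num) /\
  (forall s : R, 0 < s < 1 -> cseg_ineq c ybar s (x 0) (x s) (x 1)).

Definition NNCC_space c : Prop :=
  forall (x0 x1 : X) (ybar : Y),
    c x0 ybar \is a fin_num -> c x1 ybar \is a fin_num ->
    exists x : R -> X,
      [/\ variational_csegment c x ybar, x 0 = x0 & x 1 = x1].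

End NNCC.

(* Main.v *)
Require Import Defs.
From mathcomp Require Import all_boot all_order all_algebra.
From mathcomp Require Import all_classical all_reals ereal.

Set Implicit Arguments.
Unset Strict Implicit.
Unset Printing Implicit Defensive.

Import Order.TTheory GRing.Theory Num.Theory.

Local Open Scope classical_set_scope.
Local Open Scope ring_scope.

(** Write [cdiff c x ybar y] for [c x y - c x ybar].  With [c x ybar] and
    [phi ybar] finite, the infimum defining the c-transform says that [x] lies
    in the c-subdifferential of [phi] at [ybar] iff
    [phi y - phi ybar <= cdiff c x ybar y] for all [y] ([csubdiffP]): among the
    functions having [x] as a c-subgradient at [ybar], the slice
    [cdiff c x ybar] is the largest up to additive constants.  The rules on
    undefined sums match exactly under negation: the one that makes
    interpolated functions -oo makes the right-hand side of the c-segment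
    inequality +oo.  Hence (i) is precisely the statement that [xt] is a
    c-subgradient at [ybar] of the interpolation of the two slices
    ([cseg_ineq_csubdiff]).

    Part (A) follows.  (i) gives (iii) because interpolation is monotone, so
    the slices are the worst case; (ii) gives (i) because the slices belong to
    [Phi_tilde c] ([cdiff_Phi_tilde]).

    For part (B), a point where the interpolation is finite is one where both
    functions are finite; choosing a c-subgradient for each there, a c-segment
    between the two provides, by (A), a c-subgradient of the interpolation.
    Conversely, the interpolations of two slices are finite at [ybar], so
    convexity gives them a c-subgradient there for every [s]; choosing one for
    each [s] produces a c-segment, no regularity in [s] being asked. *)

(** * Extended-real inequalities *)

Section ExtendedReals.
Context {R : realType}.
Implicit Types (a b p q : \bar R) (r s : R).

(** When [p] and [q] are the same infinity, the dual rule makes [q - p] equal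
    to +oo, while [p - a] and [q - b] are both that infinity: the convention
    inside the infimum is the one that lets the two terms be exchanged, leaving
    only finite quantities to subtract. *)
Lemma lee_dsub_cross a b p q : a \is a fin_num -> b \is a fin_num ->
  (b - a <= (q - p)%dE)%E = (p - a <= q - b)%E.
Proof.
case: a => [a| |] //; case: b => [b| |] // _ _.
case: p => [p| |]; case: q => [q| |] //=; rewrite ?leey ?leNye //.
rewrite !lee_fin -[LHS]subr_ge0 -[RHS]subr_ge0 !opprB.
by rewrite addrACA [in RHS]addrACA [- p - b]addrC.
Qed.

Lemma fin_num_pmull r p : 0 < r -> (r%:E * p \is a fin_num)%E = (p \is a fin_num).
Proof.
by move=> r0; case: p => [p| |] //=; rewrite ?gt0_muley ?gt0_muleNy ?lte_fin.
Qed.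

(** Negation exchanges the two rules on undefined sums. *)
Lemma daddeN p q : ((- p)%E + (- q)%E)%dE = (- (p + q))%E.
Proof. by rewrite DualAddTheoryNumDomain.dual_addeE !oppeK. Qed.

End ExtendedReals.

(** * Slices of the cost, c-subgradients and c-segments *)

Section Csubdiff.
Context {R : realType} {X Y : Type}.
Variable c : X -> Y -> \bar R.
Implicit Types (phi : Y -> \bar R) (x : X) (y ybar : Y) (s : R).

Definition cdiff x ybar y : \bar R := (c x y - c x ybar)%E.

Lemma cdiff_diag x ybar : c x ybar \is a fin_num -> cdiff x ybar ybar = 0%E.
Proof. exact: subee. Qed.

(** Taking [y = ybar] in the infimum shows that
    [c x ybar - phi ybar] is always an upper bound of the c-transform, so the
    defining equality only asks that it be a lower bound. *)
Lemma csubdiffP phi ybar x :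
  csubdiff c phi ybar x <->
  [/\ phi ybar \is a fin_num, c x ybar \is a fin_num
    & forall y, (phi y - phi ybar <= cdiff x ybar y)%E].
Proof.
split=> [[fphi fc eqc]|[fphi fc lec]]; split=> //.
  move=> y; rewrite -lee_dsub_cross // -eqc addeK //.
  by apply: ereal_inf_lbound; exists y.
have -> : ctransform c phi x = (c x ybar - phi ybar)%E; last by rewrite subeK.
apply/eqP; rewrite eq_le; apply/andP; split.
  apply: ereal_inf_lbound; exists ybar => //.
  by rewrite DualAddTheoryNumDomain.dual_addeE_def // fin_num_adde_defr.
by apply: le_ereal_inf_tmp => _ [y _ <-]; rewrite lee_dsub_cross //; apply: lec.
Qed.

(** Slices of the cost at the same [x] with different base points differ by a
    finite constant, so their increments agree and the bound of [csubdiffP]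
    is an equality. *)
Lemma csubdiff_cdiff x ybar y :
  c x ybar \is a fin_num -> c x y \is a fin_num ->
  csubdiff c (cdiff x ybar) y x.
Proof.
move=> fxb fxy; apply/csubdiffP; split=> //; first by rewrite fin_numB fxy.
by move=> z; rewrite /cdiff fin_num_oppeB // addeA addeAC subeK.
Qed.

Lemma cdiff_Phi_tilde x ybar :
  c x ybar \is a fin_num -> Phi_tilde c (cdiff x ybar).
Proof.
move=> fxb y; rewrite fin_numB => /andP[fxy _].
by exists x; apply: csubdiff_cdiff.
Qed.

Lemma fin_num_phi_interp s phi0 phi1 y : 0 < s < 1 ->
  (phi_interp s phi0 phi1 y \is a fin_num)
  = (phi0 y \is a fin_num) && (phi1 y \is a fin_num).
Proof.
by case/andP=> s0 s1; rewrite fin_numD !fin_num_pmull // subr_gt0.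
Qed.

Lemma phi_interp_sub s phi0 phi1 ybar y :
  phi0 ybar \is a fin_num -> phi1 ybar \is a fin_num ->
  (phi_interp s phi0 phi1 y - phi_interp s phi0 phi1 ybar)%E =
  phi_interp s (fun z => phi0 z - phi0 ybar)%E (fun z => phi1 z - phi1 ybar)%E y.
Proof.
move=> f0 f1; rewrite /phi_interp fin_num_oppeD ?fin_numM //.
by rewrite addeACA !muleBr // adde_defN fin_num_adde_defl.
Qed.

Lemma phi_interp_le s phi0 phi1 psi0 psi1 y : 0 < s < 1 ->
  (phi0 y <= psi0 y)%E -> (phi1 y <= psi1 y)%E ->
  (phi_interp s phi0 phi1 y <= phi_interp s psi0 psi1 y)%E.
Proof.
case/andP=> s0 s1 le0 le1.
by apply: leeD; apply: lee_wpmul2l; rewrite // lee_fin ?subr_ge0 ltW.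
Qed.

Section CsegIneq.
Variables (x0 x1 xt : X) (ybar : Y) (s : R).
Hypotheses (f0 : c x0 ybar \is a fin_num) (f1 : c x1 ybar \is a fin_num).
Hypothesis s01 : 0 < s < 1.

(** Changing all signs turns the dual sum of the c-segment inequality into the
    ordinary sum used by interpolation. *)
Lemma cseg_ineqE : c xt ybar \is a fin_num ->
  cseg_ineq c ybar s x0 xt x1 <->
  forall y, (phi_interp s (cdiff x0 ybar) (cdiff x1 ybar) y
             <= cdiff xt ybar y)%E.
Proof.
have cE x y : c x ybar \is a fin_num -> (c x ybar - c x y)%E = (- cdiff x ybar y)%E.
  by move=> fx; rewrite fin_num_oppeB // addeC.
by move=> ft; split=> H y; have := H y; rewrite !cE // !muleN daddeN leeN2.
Qed.

Lemma cseg_ineq_csubdiff :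
  (c xt ybar \is a fin_num /\ cseg_ineq c ybar s x0 xt x1) <->
  csubdiff c (phi_interp s (cdiff x0 ybar) (cdiff x1 ybar)) ybar xt.
Proof.
have E0 : phi_interp s (cdiff x0 ybar) (cdiff x1 ybar) ybar = 0%E.
  by rewrite /phi_interp !cdiff_diag // !mule0 adde0.
split=> [[ft /cseg_ineqE H]|/csubdiffP[_ ft H]].
  by apply/csubdiffP; split=> [||y]; rewrite ?E0 ?sube0 //; apply: H.
split=> //; apply/cseg_ineqE => // y.
by have := H y; rewrite E0 sube0.
Qed.

(** The slices dominate the increments of [phi0] and [phi1], and interpolation
    is monotone, so a c-subgradient of the interpolated slices is one of the
    interpolation of [phi0] and [phi1]. *)
Lemma csubdiff_phi_interp phi0 phi1 :
  csubdiff c (phi_interp s (cdiff x0 ybar) (cdiff x1 ybar)) ybar xt ->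
  csubdiff c phi0 ybar x0 -> csubdiff c phi1 ybar x1 ->
  csubdiff c (phi_interp s phi0 phi1) ybar xt.
Proof.
move=> /cseg_ineq_csubdiff[ft /cseg_ineqE H] /csubdiffP[p0 _ le0].
move=> /csubdiffP[p1 _ le1]; apply/csubdiffP; split=> // [|y].
  by rewrite fin_num_phi_interp // p0.
by rewrite phi_interp_sub //; apply: le_trans (H ft y); apply: phi_interp_le.
Qed.

End CsegIneq.

(** A path is an arbitrary function, so intermediate points given for each
    [s] separately can be assembled by choice. *)
Lemma NNCC_space_of_points :
  (forall x0 x1 ybar s, c x0 ybar \is a fin_num -> c x1 ybar \is a fin_num ->
     0 < s < 1 ->
     exists xt, c xt ybar \is a fin_num /\ cseg_ineq c ybar s x0 xt x1) ->
  NNCC_space c.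
Proof.
move=> H x0 x1 ybar f0 f1.
have /choice[x Hx] (s : R) : exists xt : X,
    [/\ c xt ybar \is a fin_num, s = 0 -> xt = x0, s = 1 -> xt = x1
      & 0 < s < 1 -> cseg_ineq c ybar s x0 xt x1].
  have [->|s0] := eqVneq s 0.
    by exists x0; split; rewrite ?ltxx // => /esym/eqP; rewrite oner_eq0.
  have [->|s1] := eqVneq s 1.
    by exists x1; split; rewrite ?ltxx ?andbF // => /eqP; rewrite oner_eq0.
  have [s01|s01] := boolP (0 < s < 1); last first.
    (* [s] is outside [0, 1] here, where the value of the path is arbitrary. *)
    by exists x0; split=> // e; rewrite e eqxx in s1.
  have [xt [ft Ht]] := H x0 x1 ybar s f0 f1 s01.
  exists xt; split=> // e; [by rewrite e eqxx in s0 | by rewrite e eqxx in s1].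
have x0E : x 0 = x0 by have [_ e _ _] := Hx 0; apply: e.
have x1E : x 1 = x1 by have [_ _ e _] := Hx 1; apply: e.
exists x; split=> //; split=> s s01; first by have [] := Hx s.
by rewrite x0E x1E; have [_ _ _] := Hx s; apply.
Qed.

End Csubdiff.

(** * c-Segments and convexity of the c-subdifferentiable functions *)

Theorem proposition2p36 (R : realType) (X Y : Type) (c : X -> Y -> \bar R) :
  (forall (x0 x1 xt : X) (ybar : Y) (s : R),
     c x0 ybar \is a fin_num -> c x1 ybar \is a fin_num -> 0 < s < 1 ->
     let i := c xt ybar \is a fin_num /\ cseg_ineq c ybar s x0 xt x1 in
     let ii := forall phi0 phi1 : Y -> \bar R,
       Phi_tilde c phi0 -> Phi_tilde c phi1 ->
       csubdiff c phi0 ybar x0 -> csubdiff c phi1 ybar x1 ->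
       csubdiff c (phi_interp s phi0 phi1) ybar xt in
     let iii := forall phi0 phi1 : Y -> \bar R,
       csubdiff c phi0 ybar x0 -> csubdiff c phi1 ybar x1 ->
       csubdiff c (phi_interp s phi0 phi1) ybar xt in
     (i <-> ii) /\ (ii <-> iii))
  /\
  (NNCC_space c <->
   (forall phi0 phi1 : Y -> \bar R,
      Phi_tilde c phi0 -> Phi_tilde c phi1 ->
      forall s : R, 0 < s < 1 -> Phi_tilde c (phi_interp s phi0 phi1))).
Proof.
split=> [x0 x1 xt ybar s f0 f1 s01 i ii iii|].
  have i_iii : i -> iii.
    by move=> /(cseg_ineq_csubdiff xt s f0 f1) H phi0 phi1;
       apply: csubdiff_phi_interp.
  have iii_ii : iii -> ii by move=> H phi0 phi1 _ _; apply: H.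
  have ii_i : ii -> i.
    move=> H; apply/cseg_ineq_csubdiff => //.
    by apply: H; [exact: cdiff_Phi_tilde..|exact: csubdiff_cdiff|
                  exact: csubdiff_cdiff].
  split; split; [by move/i_iii/iii_ii|exact: ii_i|by move/ii_i/i_iii|
                exact: iii_ii].
split=> [nncc phi0 phi1 P0 P1 s s01 y|convex].
  rewrite fin_num_phi_interp // => /andP[p0 p1].
  have [x0 d0] := P0 y p0; have [x1 d1] := P1 y p1.
  have /csubdiffP[_ f0 _] := d0; have /csubdiffP[_ f1 _] := d1.
  have [x [[xfin xseg] x0E x1E]] := nncc x0 x1 y f0 f1.
  exists (x s); apply: (csubdiff_phi_interp f0 f1 s01) d0 d1.
  apply/cseg_ineq_csubdiff => //; split.
    by case/andP: s01 => s0 s1; apply: xfin; rewrite !ltW.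
  by rewrite -x0E -x1E; apply: xseg.
apply: NNCC_space_of_points => x0 x1 ybar s f0 f1 s01.
have [|xt Ht] :=
  convex _ _ (cdiff_Phi_tilde f0) (cdiff_Phi_tilde f1) s s01 ybar.
  by rewrite fin_num_phi_interp // !cdiff_diag.
by exists xt; apply/cseg_ineq_csubdiff.
Qed.
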